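(* The column-and-constraint generation algorithm for the two-stage robust bilevel facility location problem (2-stage RBO-FLP) described in the context, with tolerance $\epsilon=0.1\%$, generates an optimal solution of 2-stage RBO-FLP within a finite number of iterations.
   Context: Data: finite nonempty sets $N$ (customers) and $F$ (facilities); real numbers, all nonnegative: fixed cost $f_j$ and capacity $K_j$ for $j\in F$; demand $d_i$ and unit unmet-demand penalty $\rho_i$ for $i\in N$; unit allocation cost $c_{ij}$ for $i\in N,j\in F$; and a nonnegative integer $\Gamma$. Uncertainty set: $\mathcal U=\{s\in\{0,1\}^{F}:\sum_{j\in F}s_j\le\Gamma\}$; for $y\in\{0,1\}^F$, $\mathcal U(y)=\{s\in\mathcal U: s_j\le y_j\ \forall j\in F\}$. For $y\in\{0,1\}^F$ and $s\in\mathcal U$, let $X(y,s)$ be the set of $(x,u)\in\mathbb R^{N\times F}\times\mathbb R^{N}$ with $x\ge0$, $u\ge0$, $\sum_{i\in N}x_{ij}\le K_jy_j(1-s_j)$ for all $j\in F$, and $\sum_{j\in F}x_{ij}+u_i=d_i$ for all $i\in N$. Let $\phi(y,s)=\operatorname{argmin}\{\sum_{i\in N}u_i:(x,u)\in X(y,s)\}$. 2-stage RBO-FLP: $\min_{y\in\{0,1\}^{F}}\Big(\sum_{j}f_jy_j+\max_{s\in\mathcal U}\min_{(x,u)\in\phi(y,s)}\big(\sum_{i}\sum_{j}c_{ij}x_{ij}+\sum_{i}\rho_iu_i\big)\Big)$. Master problem for a finite list $S$ of scenarios in $\mathcal U$: minimize $\eta$ over $\eta\in\mathbb R$, $y\in\{0,1\}^F$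 and $(x^{s},u^{s})\in\phi(y,s)$ for $s\in S$, subject to $\eta\ge\sum_jf_jy_j+\sum_i\sum_jc_{ij}x^{s}_{ij}+\sum_i\rho_iu^{s}_i$ for all $s\in S$. Subproblem for given $y^*\in\{0,1\}^F$: $\psi(y^* )=\max_{s\in\mathcal U(y^* )}\min_{(x,u)\in\phi(y^*,s)}\big(\sum_jf_jy_j^*+\sum_i\sum_jc_{ij}x_{ij}+\sum_i\rho_iu_i\big)$. Algorithm. Step 1: set $LB=-\infty$, $UB=+\infty$, $S=\{\mathbf 0\}$, $\epsilon=0.1\%$. Step 2: solve the master problem for $S$, obtaining its optimal value $\eta$ and an optimal first-stage decision $y^*$; set $LB=\max\{LB,\eta\}$. Step 3: solve the subproblem for $y^*$, obtaining its optimal value $\psi=\psi(y^* )$ and a worst-case (optimal) scenario $s^*$; set $UB=\min\{\psi,UB\}$. Step 4: if $(UB-LB)/UB\le\epsilon$, terminate; otherwise add $s^*$ to $S$ (with its corresponding recourse variables and constraints in the master problem) and return to Step 2. The solution generated is the first-stage decision attaining the final value of $UB$.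
   Formalization: With tolerance 0.1% the generated solution need not be exactly optimal, so ''optimal'' is proved there as optimal up to a relative gap of 0.1% of its own value; exact optimality in finitely many iterations is proved for the same algorithm with tolerance 0. *)

(* Defs.v *)
From HB Require Import structures.
From mathcomp Require Import all_boot all_order all_algebra.
From mathcomp Require Import all_classical all_reals all_analysis.

Set Implicit Arguments.
Unset Strict Implicit.
Unset Printing Implicit Defensive.

Import Order.TTheory GRing.Theory Num.Theory.

Local Open Scope classical_set_scope.
Local Open Scope ring_scope.

(** MathComp-Analysis development: the two-stage robust bilevel facility
    location problem and its column-and-constraint generation algorithm. *)

Definition argmin (R : realType) (T : Type) (A : set T) (g : T -> R) : set T :=
  [set a | A a /\ forall b, A b -> g a <= g b].

Definition argmax (R : realType) (T : Type) (A : set T) (g : T -> R) : set T :=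
  [set a | A a /\ forall b, A b -> g b <= g a].

(** Real-valued [inf] and [sup] (junk value 0 on sets without a finite bound).
    For nonnegative data, every set they are applied to below is nonempty and
    attains the bound: the lower-level sets are nonempty and compact, the
    scenario sets nonempty and finite. *)
Definition minval (R : realType) (T : Type) (A : set T) (g : T -> R) : R :=
  inf (g @` A).

Definition maxval (R : realType) (T : Type) (A : set T) (g : T -> R) : R :=
  sup (g @` A).

Record flp_data (R : realType) (N F : finType) := FlpData {
  fixed_cost : F -> R;
  capacity : F -> R;
  demand : N -> R;
  penalty : N -> R;
  alloc_cost : N -> F -> R;
  Gamma : nat }.

Definition nonneg_data (R : realType) (N F : finType) (D : flp_data R N F) :
    Prop :=
  [/\ forall j, 0 <= fixed_cost D j, forall j, 0 <= capacity D j,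
      forall i, 0 <= demand D i, forall i, 0 <= penalty D i &
      forall i j, 0 <= alloc_cost D i j].

(** [{0,1}^F]; used both for first-stage decisions and for scenarios. *)
Definition binvec (F : finType) := {ffun F -> bool}.

Definition binvec0 (F : finType) : binvec F := [ffun=> false].

Definition recourse (R : realType) (N F : finType) : Type :=
  ((N -> F -> R) * (N -> R))%type.

Section Problem.

Context (R : realType) (N F : finType) (D : flp_data R N F).

Implicit Types (y s : binvec F) (xu : recourse R N F).

Definition uncertainty : set (binvec F) :=
  [set s : binvec F | (\sum_j (s j : nat) <= Gamma D)%N].

Definition uncertainty_of y : set (binvec F) :=
  uncertainty `&` [set s : binvec F | forall j, (s j <= y j)%N].

Definition recourse_set y s : set (recourse R N F) :=
  [set xu : recourse R N F | [/\ forall i j, 0 <= xu.1 i j,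
                forall i, 0 <= xu.2 i,
                forall j, \sum_i xu.1 i j
                  <= capacity D j * (y j)%:R * (1 - (s j)%:R) &
                forall i, \sum_j xu.1 i j + xu.2 i = demand D i]].

Definition lower_level y s : set (recourse R N F) :=
  argmin (recourse_set y s) (fun xu => \sum_i xu.2 i).

Definition first_stage_cost y : R := \sum_j fixed_cost D j * (y j)%:R.

Definition second_stage_cost xu : R :=
  \sum_i \sum_j alloc_cost D i j * xu.1 i j + \sum_i penalty D i * xu.2 i.

Definition rbo_objective y : R :=
  first_stage_cost y +
  maxval uncertainty (fun s => minval (lower_level y s) second_stage_cost).

Definition rbo_optimal : set (binvec F) := argmin setT rbo_objective.

(** Optimality up to the relative gap [eps], measured, as in the stopping test
    of the algorithm, relative to the value of the solution itself. *)
Definition rbo_optimal_within (eps : R) : set (binvec F) :=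
  [set y | forall y', rbo_objective y - rbo_objective y'
                      <= eps * rbo_objective y].

(** A point [(eta, y, xus)] of the master problem; [xus s] is the copy
    [(x^s, u^s)] of the recourse variables, only meaningful for [s \in S]. *)
Definition master_point : Type :=
  (R * binvec F * (binvec F -> recourse R N F))%type.

Definition master_feasible (S : seq (binvec F)) : set master_point :=
  [set z : master_point | let: (eta, y, xus) := z in
     forall s, s \in S -> lower_level y s (xus s) /\
       first_stage_cost y + second_stage_cost (xus s) <= eta].

Definition master_optimal (S : seq (binvec F)) : set master_point :=
  argmin (master_feasible S) (fun z : master_point => z.1.1).

Definition sub_value y s : R :=
  minval (lower_level y s)
         (fun xu => first_stage_cost y + second_stage_cost xu).

Definition psi y : R := maxval (uncertainty_of y) (sub_value y).

Definition worst_case y : set (binvec F) :=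
  argmax (uncertainty_of y) (sub_value y).

(** [visited] lists the first-stage decisions returned so far by the master
    problem; the algorithm itself only reads the other fields. *)
Record state := State {
  LB : \bar R;
  UB : \bar R;
  scenarios : seq (binvec F);
  visited : seq (binvec F);
  stopped : bool }.

Definition init_state : state :=
  State -oo%E +oo%E [:: binvec0 F] [::] false.

(** Solve the master problem, solve the subproblem, update the bounds, then
    stop or add the scenario; any choice of the optimal solutions is allowed.
    After the bounds are updated both are real numbers; when [UB = 0], the
    ratio in the stopping test is [0 / 0 = 0], since then [LB = 0] too. *)
Definition iteration (eps : R) (a b : state) : Prop :=
  ~~ stopped a /\
  exists (eta : R) (ystar : binvec F) (xus : binvec F -> recourse R N F)
      (sstar : binvec F),
    [/\ master_optimal (scenarios a) (eta, ystar, xus),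
        worst_case ystar sstar &
        let lb := maxe (LB a) eta%:E in
        let ub := mine (psi ystar)%:E (UB a) in
        let stop := ((ub - lb) / ub <= eps%:E)%E in
        b = State lb ub
              (if stop then scenarios a else rcons (scenarios a) sstar)
              (rcons (visited a) ystar) stop].

Fixpoint reachable (eps : R) (n : nat) (b : state) : Prop :=
  if n is m.+1 then exists2 a, reachable eps m a & iteration eps a b
  else b = init_state.

Definition generated (b : state) : set (binvec F) :=
  [set y | y \in visited b /\ (psi y)%:E = UB b].

(** Whatever optimal solutions are chosen along the way: the number of
    iterations is bounded, every iteration that is due can be carried out, and
    on termination a solution is generated and all generated ones are in
    [good]. *)
Definition finitely_generates (eps : R) (good : set (binvec F)) : Prop :=
  [/\ exists K : nat, forall n b, reachable eps n b -> (n <= K)%N,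
      forall n a, reachable eps n a -> ~~ stopped a ->
        exists b, iteration eps a b &
      forall n b, reachable eps n b -> stopped b ->
        generated b !=set0 /\ generated b `<=` good].

End Problem.

Definition tolerance (R : realType) : R := 1 / 1000.

(* Main.v *)
(** Every objective occurring in the algorithm is attained: the recourse
    polytopes are nonempty and compact, and there are finitely many binary
    vectors. Attacking a closed facility has no effect, so [psi y] is the true
    objective value of [y]; hence [LB] never exceeds the optimal value, while
    [UB] is the value of a visited decision. If a decision is visited twice, the
    scenario added at its first visit forces the master value up to [psi y], so
    [LB = UB] and the algorithm stops; the number of iterations is therefore at
    most [2 ^ #|F| + 1]. *)

Require Import Defs.
From mathcomp Require Import all_boot all_order all_algebra.
From mathcomp Require Import all_classical all_reals all_analysis.

Set Implicit Arguments.
Unset Strict Implicit.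
Unset Printing Implicit Defensive.

Import Order.TTheory GRing.Theory Num.Theory.
Import numFieldNormedType.Exports.

Local Open Scope classical_set_scope.
Local Open Scope ring_scope.

(** * Attained extrema, closed sets and continuity *)

Lemma closed_forall (T : topologicalType) (I : Type) (P : I -> set T) :
  (forall i, closed (P i)) -> closed [set x | forall i, P i x].
Proof.
move=> cP; have -> : [set x | forall i, P i x] = \bigcap_i P i.
  by apply/seteqP; split=> x /= Px i; [move=> _; exact: Px|exact: Px].
by apply: closed_bigI => i _; exact: cP.
Qed.

Section Extrema.
Context (R : realType).

(** A minimiser makes the image nonempty and bounded below, so [inf] does not take its default
    value. *)
Lemma minvalE (T : Type) (A : set T) (g : T -> R) (a : T) :
  argmin A g a -> minval A g = g a.
Proof.
move=> [Aa ga]; apply/eqP; rewrite eq_le; apply/andP; split.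
  by apply: ge_inf; [exists (g a) => _ [b Ab <-]; exact: ga|exists a].
by apply: lb_le_inf; [exists (g a); exists a|move=> _ [b Ab <-]; exact: ga].
Qed.

Lemma maxvalE (T : Type) (A : set T) (g : T -> R) (a : T) :
  argmax A g a -> maxval A g = g a.
Proof.
move=> [Aa ga]; apply/eqP; rewrite eq_le; apply/andP; split.
  by apply: ge_sup; [exists (g a); exists a|move=> _ [b Ab <-]; exact: ga].
by apply: ub_le_sup; [exists (g a) => _ [b Ab <-]; exact: ga|exists a].
Qed.

Lemma finite_argmax (T : finType) (A : set T) (g : T -> R) :
  A !=set0 -> argmax A g !=set0.
Proof.
move=> [a /asboolP Aa].
case: (arg_maxP g (P := fun x => `[<A x>]) Aa) => b /asboolP Ab gb.
by exists b; split=> // c /asboolP /gb.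
Qed.

Lemma finite_argmin (T : finType) (A : set T) (g : T -> R) :
  A !=set0 -> argmin A g !=set0.
Proof.
move=> /(finite_argmax (fun x => - g x))[a [Aa ga]]; exists a; split=> // b Ab.
by rewrite -lerN2; exact: ga.
Qed.

Lemma closed_sublevel (T : topologicalType) (g : T -> R) (a : R) :
  continuous g -> closed [set x | g x <= a].
Proof.
move=> cg; apply: (@preimage_closed _ _ g [set x | x <= a]) => [x _|].
  exact: cg.
exact: closed_le.
Qed.

(** The minimisers are [A] cut by a closed sublevel set. Their compactness is what allows a second
    minimisation over them, as the bilevel structure requires. *)
Lemma compact_argmin (T : topologicalType) (A : set T) (g : T -> R) :
  A !=set0 -> compact A -> continuous g ->
  argmin A g !=set0 /\ compact (argmin A g).
Proof.
move=> A0 cA cg.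
have [|a /[!inE] Aa ga] := compact_EVT_min (f := g) A0 cA.
  exact: continuous_subspaceT.
have {}ga b : A b -> g a <= g b by move=> Ab; apply: ga; rewrite inE.
split; first by exists a.
have -> : argmin A g = A `&` [set x | g x <= g a].
  apply/seteqP; split=> [b [Ab gb]|b [Ab /= gba]]; split => //.
    exact: gb.
  by move=> c Ac; exact: le_trans (ga c Ac).
apply: compact_closedI; [exact: cA|exact: closed_sublevel].
Qed.

Lemma continuous_sum (T : topologicalType) (I : finType) (g : I -> T -> R) :
  (forall i, continuous (g i)) -> continuous (fun x => \sum_i g i x).
Proof.
move=> cg; apply: continuous_big => // x; exact: add_continuous.
Qed.

Lemma closed_superlevel (T : topologicalType) (g : T -> R) (a : R) :
  continuous g -> closed [set x | a <= g x].
Proof.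
move=> cg; apply: (@preimage_closed _ _ g [set x | a <= x]) => [x _|].
  exact: cg.
exact: closed_ge.
Qed.

Lemma closed_level (T : topologicalType) (g : T -> R) (a : R) :
  continuous g -> closed [set x | g x = a].
Proof.
move=> cg; apply: (@preimage_closed _ _ g [set x | x = a]) => [x _|].
  exact: cg.
exact: closed_eq.
Qed.

Lemma continuous_scale (T : topologicalType) (a : R) (g : T -> R) :
  continuous g -> continuous (fun x => a * g x).
Proof. by move=> cg x; apply: continuousM; [exact: cst_continuous|exact: cg]. Qed.

End Extrema.

(** * Compactness of the recourse polytopes and attainment in the lower level *)

Section LowerLevel.
Import ArrowAsProduct.
Context (R : realType) (N F : finType) (D : flp_data R N F).
Implicit Types (y s : binvec F) (xu : recourse R N F).

Lemma continuous_alloc (i : N) (j : F) :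
  continuous (fun xu : recourse R N F => xu.1 i j).
Proof.
move=> xu.
apply: (@cvg_comp _ _ _ (fun xu : recourse R N F => xu.1 i) (fun v => v j) _
  (nbhs (xu.1 i))).
  apply: (@cvg_comp _ _ _ (fun xu : recourse R N F => xu.1) (fun v => v i) _
    (nbhs xu.1)); first exact: cvg_fst.
  exact: (@proj_continuous _ (fun=> F -> R)).
exact: (@proj_continuous _ (fun=> R)).
Qed.

Lemma continuous_unmet (i : N) : continuous (fun xu : recourse R N F => xu.2 i).
Proof.
move=> xu; apply: (@cvg_comp _ _ _ (fun xu : recourse R N F => xu.2)
  (fun v => v i) _ (nbhs xu.2)); first exact: cvg_snd.
exact: (@proj_continuous _ (fun=> R)).
Qed.

Lemma continuous_second_stage_cost : continuous (second_stage_cost D).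
Proof.
have c1 : continuous
    (fun xu : recourse R N F => \sum_i \sum_j alloc_cost D i j * xu.1 i j).
  apply: continuous_sum => i.
  apply: continuous_sum => j.
  apply: continuous_scale; exact: continuous_alloc.
have c2 : continuous (fun xu : recourse R N F => \sum_i penalty D i * xu.2 i).
  apply: continuous_sum => i.
  apply: continuous_scale; exact: continuous_unmet.
move=> xu; exact: (continuousD (c1 xu) (c2 xu)).
Qed.

Hypothesis D_ge0 : nonneg_data D.

Lemma recourse_set_nonempty y s : recourse_set D y s !=set0.
Proof.
case: D_ge0 => _ K0 d0 _ _.
(* Serve nobody: all demand is unmet. *)
exists (fun _ _ => 0, demand D); split=> //= [j|i].
  rewrite sumr_const mul0rn !mulr_ge0// subr_ge0.
  by case: (s j).
by rewrite big1// add0r.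
Qed.

Lemma closed_recourse_set y s : closed (recourse_set D y s).
Proof.
have -> : recourse_set D y s =
    [set xu | forall i j, 0 <= xu.1 i j] `&`
    [set xu | forall i, 0 <= xu.2 i] `&`
    [set xu | forall j, \sum_i xu.1 i j
                <= capacity D j * (y j)%:R * (1 - (s j)%:R)] `&`
    [set xu | forall i, \sum_j xu.1 i j + xu.2 i = demand D i].
  by apply/seteqP; split=> [xu []//|xu [[[]]]].
apply: closedI; [apply: closedI; [apply: closedI|]|].
- apply: closed_forall => i; apply: closed_forall => j.
  apply: closed_superlevel; exact: continuous_alloc.
- apply: closed_forall => i; apply: closed_superlevel; exact: continuous_unmet.
- apply: closed_forall => j; apply: closed_sublevel.
  apply: continuous_sum => i; exact: continuous_alloc.
- apply: closed_forall => i; apply: closed_level.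
  have cx : continuous (fun xu : recourse R N F => \sum_j xu.1 i j).
    by apply: continuous_sum => j; exact: continuous_alloc.
  by move=> xu; exact: (continuousD (cx xu) (@continuous_unmet i xu)).
Qed.

(** By the demand equation and nonnegativity, each [x i j] and [u i] lies in the segment from 0 to
    [demand D i]; a product of such segments is compact by Tychonoff. *)
Lemma compact_recourse_set y s : compact (recourse_set D y s).
Proof.
pose B (i : N) : set R := `[0, demand D i]%classic.
have cB i : compact (B i) by exact: segment_compact.
apply: (@subclosed_compact _ _ ([set x : N -> F -> R | forall i j, B i (x i j)] `*`
  [set u : N -> R | forall i, B i (u i)])).
- exact: closed_recourse_set.
- apply: compact_setX.
    apply: (@tychonoff N (fun=> F -> R)
      (fun i => [set v : F -> R | forall j, B i (v j)])) => i.
    by apply: (@tychonoff F (fun=> R) (fun=> B i)) => j.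
  by apply: (@tychonoff N (fun=> R) B).
move=> xu [x0 u0 _ dE]; split=> [i j|i] /=; rewrite /B /= in_itv /=.
  rewrite x0 -(dE i) (bigD1 j)//= -addrA lerDl addr_ge0//.
  by apply: sumr_ge0 => k _; exact: x0.
by rewrite u0 -(dE i) lerDr; apply: sumr_ge0 => k _; exact: x0.
Qed.

(** [compact_argmin] is used twice: for the unmet demand, then for the cost over its minimisers. *)
Lemma lower_level_attained y s :
  argmin (lower_level D y s) (second_stage_cost D) !=set0.
Proof.
have [ll0 cll] := compact_argmin (recourse_set_nonempty y s)
  (@compact_recourse_set y s) (continuous_sum continuous_unmet).
by have [] := compact_argmin ll0 cll continuous_second_stage_cost.
Qed.

End LowerLevel.

(** * Values of the subproblem and of the master problem *)

Section Values.
Context (R : realType) (N F : finType) (D : flp_data R N F).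
Hypothesis D_ge0 : nonneg_data D.
Implicit Types (y s : binvec F) (xu : recourse R N F) (S : seq (binvec F)).

Lemma sub_value_attained y s :
  exists2 xu, lower_level D y s xu &
    sub_value D y s = first_stage_cost D y + second_stage_cost D xu.
Proof.
have [xu [llxu xu_min]] := lower_level_attained D_ge0 y s.
exists xu => //; rewrite /sub_value.
by rewrite (@minvalE _ _ _ _ xu)//; split=> // b /xu_min; rewrite lerD2l.
Qed.

Lemma sub_value_le y s xu : lower_level D y s xu ->
  sub_value D y s <= first_stage_cost D y + second_stage_cost D xu.
Proof.
move=> llxu; have [xu0 [llxu0 xu0_min]] := lower_level_attained D_ge0 y s.
rewrite /sub_value (@minvalE _ _ _ _ xu0); first by rewrite lerD2l; exact: xu0_min.
by split=> // b /xu0_min; rewrite lerD2l.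
Qed.

Lemma sub_valueE y s : sub_value D y s =
  first_stage_cost D y + minval (lower_level D y s) (second_stage_cost D).
Proof.
have [xu xu_min] := lower_level_attained D_ge0 y s.
rewrite (minvalE xu_min) /sub_value (@minvalE _ _ _ _ xu)//.
by case: xu_min => llxu xu_min; split=> // b /xu_min; rewrite lerD2l.
Qed.

Lemma sub_value_ge0 y s : 0 <= sub_value D y s.
Proof.
case: D_ge0 => f0 _ _ p0 c0.
have [xu [[x0 u0 _ _] _] ->] := sub_value_attained y s.
apply: addr_ge0; first by apply: sumr_ge0 => j _; rewrite mulr_ge0.
apply: addr_ge0; last by apply: sumr_ge0 => i _; rewrite mulr_ge0.
by apply: sumr_ge0 => i _; apply: sumr_ge0 => j _; rewrite mulr_ge0.
Qed.

Lemma uncertainty0 : uncertainty D (binvec0 F).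
Proof. by rewrite /uncertainty /= big1// => j _; rewrite ffunE. Qed.

(* Attacking a closed facility changes nothing, so [s] may be replaced by its
   restriction to the facilities opened in [y]. *)
Definition restrict y s : binvec F := [ffun j => s j && y j].

Lemma restrict_uncertainty y s :
  uncertainty D s -> uncertainty_of D y (restrict y s).
Proof.
move=> Us; split=> [|j]; last by rewrite ffunE; case: (s j) (y j) => [] [].
apply: leq_trans Us; apply: leq_sum => j _.
by rewrite ffunE; case: (s j) (y j) => [] [].
Qed.

Lemma sub_value_restrict y s : sub_value D y (restrict y s) = sub_value D y s.
Proof.
rewrite /sub_value; congr (minval (argmin _ _) _).
apply/seteqP; split=> xu [x0 u0 cap dE]; split=> // j; move: (cap j);
  by rewrite ffunE; case: (s j) (y j) => [] []; rewrite ?mulr0 ?mul0r ?subrr ?mulr0.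
Qed.

Lemma worst_case_attained y : worst_case D y !=set0.
Proof.
apply: finite_argmax; exists (restrict y (binvec0 F)).
exact/restrict_uncertainty/uncertainty0.
Qed.

Lemma psiE y s : worst_case D y s -> psi D y = sub_value D y s.
Proof. exact: maxvalE. Qed.

(** [psi] ranges over attacks on open facilities only; [restrict] extends the bound to all
    scenarios. *)
Lemma sub_value_le_psi y s : uncertainty D s -> sub_value D y s <= psi D y.
Proof.
move=> Us; have [s0 ws0] := worst_case_attained y; rewrite (psiE ws0).
by rewrite -sub_value_restrict; case: ws0 => _; apply; exact: restrict_uncertainty.
Qed.

(** A worst case within [uncertainty_of D y] is also a maximiser over all of [uncertainty D]. *)
Lemma rbo_objectiveE y : rbo_objective D y = psi D y.
Proof.
have [s0 ws0] := worst_case_attained y.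
rewrite /rbo_objective (@maxvalE _ _ _ _ s0) -?sub_valueE ?(psiE ws0)//.
split=> [|s Us]; first by case: ws0 => -[].
rewrite -(lerD2l (first_stage_cost D y)) -!sub_valueE -(psiE ws0).
exact: sub_value_le_psi.
Qed.

Lemma master_feasible_ge S eta y xus s : master_feasible D S (eta, y, xus) ->
  s \in S -> sub_value D y s <= eta.
Proof. by move=> feas /feas[/sub_value_le/le_trans]; apply. Qed.

(** Converse of [master_feasible_ge]: optimal recourses, chosen scenario by scenario, reduce the
    master problem to minimising over [y] the largest [sub_value D y s] with [s] in [S]. *)
Lemma master_feasible_exists S eta y :
  (forall s, s \in S -> sub_value D y s <= eta) ->
  exists xus, master_feasible D S (eta, y, xus).
Proof.
move=> le_eta.
have /choice[xus xusP] s : exists xu, lower_level D y s xu /\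
    sub_value D y s = first_stage_cost D y + second_stage_cost D xu.
  by have [xu ? ?] := sub_value_attained y s; exists xu.
exists xus => s sS; have [llxu <-] := xusP s.
by split=> //; exact: le_eta.
Qed.

Lemma master_optimal_exists S : S != [::] ->
  exists eta y xus, master_optimal D S (eta, y, xus).
Proof.
move=> S0.
have S1 : [set` S] !=set0.
  by case: S S0 => // s S _; exists s; rewrite /= mem_head.
(* The best [eta] for a fixed [y]; only finitely many [y] remain to be compared. *)
pose val y := maxval [set` S] (sub_value D y).
have valE y : exists2 s, s \in S & val y = sub_value D y s /\
    forall s', s' \in S -> sub_value D y s' <= val y.
  have [s ys] := finite_argmax (sub_value D y) S1; exists s; first by case: ys.
  by rewrite /val (maxvalE ys); split=> //; case: ys.
have [|y [_ y_min]] := finite_argmin val (A := setT); first by exists (binvec0 F).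
have [_ _ [_ le_val]] := valE y.
have [xus feas] := master_feasible_exists le_val.
exists (val y), y, xus; split=> // -[[eta y'] xus'] feas' /=.
apply: le_trans (y_min y' I) _; have [s sS [-> _]] := valE y'.
exact: master_feasible_ge feas' sS.
Qed.

(** The master problem is a relaxation: [y'] with bound [psi D y'] is feasible for it. *)
Lemma master_optimal_le S eta y xus y' :
  (forall s, s \in S -> uncertainty D s) ->
  master_optimal D S (eta, y, xus) -> eta <= psi D y'.
Proof.
move=> SU [_ eta_min].
have [|xus' /eta_min//] := @master_feasible_exists S (psi D y') y'.
by move=> s /SU; exact: sub_value_le_psi.
Qed.

Lemma master_optimal_ge0 S eta y xus : S != [::] ->
  master_optimal D S (eta, y, xus) -> 0 <= eta.
Proof.
case: S => // s S _ [feas _]; apply: le_trans (sub_value_ge0 y s) _.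
by apply: master_feasible_ge feas _; rewrite mem_head.
Qed.

End Values.

(** * Loop invariant, termination and the final gap *)

Section Algorithm.
Context (R : realType) (N F : finType) (D : flp_data R N F).
Hypothesis D_ge0 : nonneg_data D.
Variable eps : R.
Hypothesis eps_ge0 : 0 <= eps.
Implicit Types (y s : binvec F) (a b : state R F).
Local Open Scope ereal_scope.

(** [unstopped_cut] is the key field: while the algorithm runs, each visited decision has a
    worst-case scenario in the master problem. [LB_ge0] and [UB_attained] allow for the initial
    infinite bounds. *)
Record invariant (n : nat) b : Prop := Invariant {
  size_visited : size (visited b) = n;
  scenarios_neq0 : scenarios b != [::];
  scenarios_uncertainty : forall s, s \in scenarios b -> uncertainty D s;
  LB_le : forall y, LB b <= (psi D y)%:E;
  LB_ge0 : visited b != [::] -> 0 <= LB b;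
  UB_le : forall y, y \in visited b -> UB b <= (psi D y)%:E;
  UB_attained : UB b = +oo \/
    exists2 y, y \in visited b & UB b = (psi D y)%:E;
  unstopped_uniq : ~~ stopped b -> uniq (visited b);
  unstopped_cut : ~~ stopped b -> forall y, y \in visited b ->
    exists2 s, s \in scenarios b & sub_value D y s = psi D y;
  stopped_visited : stopped b -> visited b != [::];
  stopped_gap : stopped b -> (UB b - LB b) / UB b <= eps%:E }.

Lemma iteration_invariant n a b :
  invariant n a -> iteration D eps a b -> invariant n.+1 b.
Proof.
move=> inv [a_run [eta [y [xus [s [opt ws ->]]]]]].
set lb := maxe _ _; set ub := mine _ _; set stop := (_ <= _).
have eta_le y' : (eta <= psi D y')%R.
  exact: master_optimal_le (scenarios_uncertainty inv) opt.
have ub_le y' : y' \in rcons (visited a) y -> ub <= (psi D y')%:E.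
  rewrite mem_rcons inE ge_min => /orP[/eqP->|/(UB_le inv) ->].
    by rewrite lexx.
  by rewrite orbT.
have lb_le y' : lb <= (psi D y')%:E.
  by rewrite ge_max (LB_le inv) lee_fin eta_le.
have ub_att : exists2 y', y' \in rcons (visited a) y & ub = (psi D y')%:E.
  rewrite /ub; case: leP => [_|UBlt].
    by exists y; rewrite // mem_rcons mem_head.
  case: (UB_attained inv) => [UBoo|[y' y'a UBE]].
    by move: UBlt; rewrite UBoo ltNge leey.
  by exists y'; rewrite // mem_rcons inE y'a orbT.
have s_unc : uncertainty D s by case: ws => -[].
(* A repeated decision [y] is already cut at its worst case, which forces
   [eta >= psi y], hence equal bounds. *)
have new_visit : ~~ stop -> y \notin visited a.
  apply: contra => ya; rewrite /stop.
  have [t ta tE] := unstopped_cut inv a_run ya.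
  have lb_ge : (psi D y)%:E <= lb.
    rewrite le_max lee_fin -tE; apply/orP; right.
    by case: opt => /(master_feasible_ge D_ge0)/(_ ta).
  have [y' _ ubE] := ub_att.
  have -> : lb = ub.
    apply/eqP; rewrite eq_le {1}ubE lb_le /=.
    by apply: le_trans lb_ge; apply: ub_le; rewrite mem_rcons mem_head.
  (* The numerator is 0, so the quotient is 0 whatever the inverse of [ub] is, even for [ub = 0]. *)
  by rewrite ubE subee// mul0e lee_fin.
split=> //=.
- by rewrite size_rcons (size_visited inv).
- by case: ifP => _; [exact: scenarios_neq0 inv|case: (scenarios a)].
- move=> t; case: ifP => _; first exact: scenarios_uncertainty inv t.
  by rewrite mem_rcons inE => /orP[/eqP->|/(scenarios_uncertainty inv)].
- move=> _; rewrite le_max lee_fin.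
  by rewrite (master_optimal_ge0 D_ge0 (scenarios_neq0 inv) opt) orbT.
- by right.
- by move=> /new_visit ya; rewrite rcons_uniq ya (unstopped_uniq inv).
(* As the run goes on, [s] has been added, and it attains [psi D y]. *)
- move=> run; rewrite (negbTE run) => y'.
  rewrite mem_rcons inE => /orP[/eqP->|].
    by exists s; rewrite ?(psiE ws)// mem_rcons mem_head.
  move=> /(unstopped_cut inv a_run)[t ta tE].
  by exists t; rewrite // mem_rcons inE ta orbT.
- by case: (visited a).
Qed.

Lemma reachable_invariant n b : reachable D eps n b -> invariant n b.
Proof.
elim: n b => [|n IHn] b /=; last by case=> a /IHn; exact: iteration_invariant.
move=> ->; split=> //=.
- by move=> s; rewrite inE => /eqP->; exact: uncertainty0.
- by move=> y; rewrite leNye.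
- by left.
Qed.

Lemma iteration_exists n a : invariant n a -> ~~ stopped a ->
  exists b, iteration D eps a b.
Proof.
move=> inv a_run.
have [eta [y [xus opt]]] := master_optimal_exists D_ge0 (scenarios_neq0 inv).
have [s ws] := worst_case_attained D y.
by eexists; split=> //; exists eta, y, xus, s; split.
Qed.

(** The state before the last iteration is unstopped, so its visited decisions are distinct; the
    last iteration accounts for the successor. *)
Lemma reachable_bounded n b : reachable D eps n b -> (n <= #|binvec F|.+1)%N.
Proof.
case: n => // n [a /reachable_invariant inv [a_run _]].
rewrite ltnS -(size_visited inv) -(card_uniqP (unstopped_uniq inv a_run)).
exact: max_card.
Qed.

Lemma stopped_within_gap n b y y' : invariant n b -> stopped b ->
  generated D b y -> (psi D y - psi D y' <= eps * psi D y)%R.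
Proof.
move=> inv b_stop [_ psiUB].
have := LB_ge0 inv (stopped_visited inv b_stop).
have := stopped_gap inv b_stop.
have := LB_le inv y'; have := LB_le inv y; rewrite -psiUB.
case: (LB b) => [l| |] //; rewrite !lee_fin => l_le l_le'.
(* If [UB] is 0, the claim follows from [0 <= LB] alone; otherwise [UB] is positive and the stopping
   test can be multiplied by it. *)
have [psi0 _ l0|psi_neq0] := eqVneq (psi D y) 0%R.
  by rewrite psi0 mulr0 sub0r oppr_le0 (le_trans l0).
rewrite inver (negbTE psi_neq0) => + l0.
have psi_gt0 : (0 < psi D y)%R by rewrite lt_neqAle eq_sym psi_neq0 (le_trans l0).
rewrite lee_pdivrMr// lee_fin => gap.
by apply: le_trans gap; rewrite lerD2l lerN2.
Qed.

Lemma generates_within_gap :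
  finitely_generates D eps (rbo_optimal_within D eps).
Proof.
split; first by exists #|binvec F|.+1; exact: reachable_bounded.
  by move=> n a /reachable_invariant; exact: iteration_exists.
move=> n b /reachable_invariant inv b_stop; split; last first.
  move=> y yb y'; rewrite !(rbo_objectiveE D_ge0).
  exact: stopped_within_gap inv b_stop yb.
(* An infinite [UB] is impossible, since a stopped state has a visited decision, whose finite [psi]
   bounds [UB]. *)
have [UBoo|[y yb UBE]] := UB_attained inv; last by exists y; split.
have := stopped_visited inv b_stop; have := UB_le inv.
case: (visited b) => // y l /(_ y); rewrite mem_head UBoo => /(_ isT).
by rewrite leye_eq.
Qed.

End Algorithm.

(** Exact optimality thus becomes the instance [eps = 0] of [generates_within_gap]. *)
Lemma rbo_optimal_within0 (R : realType) (N F : finType) (D : flp_data R N F) :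
  rbo_optimal_within D 0 = rbo_optimal D.
Proof.
apply/seteqP; split=> y; last first.
  by move=> [_ y_min] y'; rewrite mul0r subr_le0; exact: y_min.
by move=> y_min; split=> // y' _; rewrite -subr_le0 -(mul0r (rbo_objective D y)).
Qed.

(** With a positive tolerance the stopping test certifies optimality up to that relative gap; exact
    optimality is obtained for the run with tolerance 0. *)
Theorem proposition6 (R : realType) (N F : finType) (D : flp_data R N F)
    (N_gt0 : (0 < #|N|)%N) (F_gt0 : (0 < #|F|)%N) (D_ge0 : nonneg_data D) :
  finitely_generates D (tolerance R) (rbo_optimal_within D (tolerance R)) /\
  finitely_generates D 0%R (rbo_optimal D).
Proof.
have tolerance_ge0 : 0 <= tolerance R := divr_ge0 (ler0n R 1) (ler0n R 1000).
split; first exact (generates_within_gap D_ge0 tolerance_ge0).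
rewrite -rbo_optimal_within0.
exact (generates_within_gap D_ge0 (lexx 0)).
Qed.
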